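(* The Lie algebra of the variational symmetry group of the functional $$\bar{\mathcal{L}}[\omega]=\int\!\!\int_D\left(-\frac12\omega_u\omega_v-e^{\omega}-\frac12e^{-2\omega}\right)du\,dv,$$ where $D$ is a domain in $\mathbb{R}^2$ and $\omega\in C^2(D)$, is described (spanned) by the vector fields $$U_1=u\frac{\partial}{\partial u}-v\frac{\partial}{\partial v},\qquad U_2=\frac{\partial}{\partial u},\qquad U_3=\frac{\partial}{\partial v}.$$
   Context: For a functional $\int\!\!\int L(u,v,\omega^{(1)})\,du\,dv$ with $\omega^{(1)}=(\omega,\omega_u,\omega_v)$, a variational symmetry group is a local group of transformations of the space of $(u,v,\omega)$ such that, whenever a transformation of the group carries the graph of $\omega=f(u,v)$ over a subdomain to the graph of $\bar\omega=\bar f(\bar u,\bar v)$, the integral of $L$ over the corresponding domains is unchanged. Its Lie algebra consists of the smooth vector fields $X=\zeta(u,v,\omega)\frac{\partial}{\partial u}+\eta(u,v,\omega)\frac{\partial}{\partial v}+\phi(u,v,\omega)\frac{\partial}{\partial\omega}$ satisfying $\mathrm{pr}^{(1)}X(L)+L\,(D_u\zeta+D_v\eta)=0$ identically on the jet space, where $D_u,D_v$ are total derivatives and $\mathrm{pr}^{(1)}X=X+\phi^u\frac{\partial}{\partial\omega_u}+\phi^v\frac{\partial}{\partial\omega_v}$ with $\phi^u=D_u(\phi-\zeta\omega_u-\eta\omega_v)+\zeta\omega_{uu}+\eta\omega_{uv}$, $\phi^v=D_v(\phi-\zeta\omega_u-\eta\omega_v)+\zeta\omega_{uv}+\eta\omega_{vv}$.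 *)

(* Defs.v *)
From mathcomp Require Import all_boot all_order all_algebra.
From mathcomp Require Import all_classical all_reals all_analysis.
Import Order.TTheory GRing.Theory Num.Theory numFieldNormedType.Exports.

Set Implicit Arguments.
Unset Strict Implicit.
Unset Printing Implicit Defensive.

Local Open Scope classical_set_scope.
Local Open Scope ring_scope.

(* Coordinates (u, v, w), (u, v, w, w_u, w_v) and
   (u, v, w, w_u, w_v, w_uu, w_uv, w_vv), where w is the dependent variable. *)
Notation J0 R := (R * R * R)%type.
Notation J1 R := (R * R * R * R * R)%type.
Notation J2 R := (R * R * R * R * R * R * R * R)%type.

Section Definitions.
Context {R : realType}.

(* C^n on M: all iterated partial derivatives of order at most n exist and are
   jointly continuous at every point of M (which is meant to be open). *)
Fixpoint Cn (M : set (J0 R)) (n : nat) (f : J0 R -> R) : Prop :=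
  (forall x, M x -> {for x, continuous f}) /\
  if n is m.+1 then
    forall e : J0 R, e \in [:: (1, 0, 0); (0, 1, 0); (0, 0, 1)] ->
      (forall x, M x -> derivable f x e) /\ Cn M m ('D_e f)
  else True.

Definition smooth (M : set (J0 R)) (f : J0 R -> R) : Prop :=
  forall n, Cn M n f.

(* X x = (zeta x, eta x, phi x) stands for
   zeta d/du + eta d/dv + phi d/dw. *)
Definition vfield : Type := J0 R -> J0 R.

Definition zeta (X : vfield) (x : J0 R) : R := (X x).1.1.
Definition eta (X : vfield) (x : J0 R) : R := (X x).1.2.
Definition phi (X : vfield) (x : J0 R) : R := (X x).2.

Definition smooth_vfield (M : set (J0 R)) (X : vfield) : Prop :=
  [/\ smooth M (zeta X), smooth M (eta X) & smooth M (phi X)].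

Definition Du (F : J1 R -> R) : J2 R -> R :=
  fun '(u, v, w, wu, wv, wuu, wuv, wvv) =>
    let z := (u, v, w, wu, wv) in
    'D_(1, 0, 0, 0, 0) F z + wu * 'D_(0, 0, 1, 0, 0) F z
    + wuu * 'D_(0, 0, 0, 1, 0) F z + wuv * 'D_(0, 0, 0, 0, 1) F z.

Definition Dv (F : J1 R -> R) : J2 R -> R :=
  fun '(u, v, w, wu, wv, wuu, wuv, wvv) =>
    let z := (u, v, w, wu, wv) in
    'D_(0, 1, 0, 0, 0) F z + wv * 'D_(0, 0, 1, 0, 0) F z
    + wuv * 'D_(0, 0, 0, 1, 0) F z + wvv * 'D_(0, 0, 0, 0, 1) F z.

Definition lift (f : J0 R -> R) : J1 R -> R :=
  fun '(u, v, w, wu, wv) => f (u, v, w).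

Definition characteristic (X : vfield) : J1 R -> R :=
  fun '(u, v, w, wu, wv) =>
    let x := (u, v, w) in phi X x - zeta X x * wu - eta X x * wv.

Definition phi_u (X : vfield) : J2 R -> R :=
  fun '((u, v, w, wu, wv, wuu, wuv, wvv) as z) =>
    let x := (u, v, w) in
    Du (characteristic X) z + zeta X x * wuu + eta X x * wuv.

Definition phi_v (X : vfield) : J2 R -> R :=
  fun '((u, v, w, wu, wv, wuu, wuv, wvv) as z) =>
    let x := (u, v, w) in
    Dv (characteristic X) z + zeta X x * wuv + eta X x * wvv.

(* The second-order coordinates cancel in phi_u and phi_v, but as written these
   are functions on the second jet space, hence so is pr^(1) X (L). *)
Definition pr1 (X : vfield) (L : J1 R -> R) : J2 R -> R :=
  fun '((u, v, w, wu, wv, wuu, wuv, wvv) as z) =>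
    let x := (u, v, w) in
    let y := (u, v, w, wu, wv) in
    zeta X x * 'D_(1, 0, 0, 0, 0) L y + eta X x * 'D_(0, 1, 0, 0, 0) L y
    + phi X x * 'D_(0, 0, 1, 0, 0) L y
    + phi_u X z * 'D_(0, 0, 0, 1, 0) L y + phi_v X z * 'D_(0, 0, 0, 0, 1) L y.

(* X belongs to the Lie algebra of the variational symmetry group of the
   functional with Lagrangian L over D. A vector field on D x R is a function on R^3 of which
   only the values over D are used. *)
Definition variational_symmetry (D : set (R * R)) (L : J1 R -> R) (X : vfield) :
    Prop :=
  smooth_vfield (D `*` setT) X /\
  forall u v w wu wv wuu wuv wvv : R, D (u, v) ->
    let z := (u, v, w, wu, wv, wuu, wuv, wvv) in
    pr1 X L z
    + L (u, v, w, wu, wv) * (Du (lift (zeta X)) z + Dv (lift (eta X)) z) = 0.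

Definition lagrangian : J1 R -> R :=
  fun '(u, v, w, wu, wv) =>
    - (1 / 2) * (wu * wv) - expR w - 1 / 2 * expR (- 2 * w).

Definition U1 : vfield := fun '(u, v, w) => (u, - v, 0).
Definition U2 : vfield := fun=> (1, 0, 0).
Definition U3 : vfield := fun=> (0, 1, 0).

End Definitions.

Arguments vfield : clear implicits.

(* Main.v *)
(* Comparing coefficients of the monomials in w_u and w_v, the symmetry
   condition gives zeta_v = zeta_w = eta_u = eta_w = phi_w = 0 together with
   phi V'(w) + V(w) (zeta_u + eta_v) = 0 for V(w) = e^w + e^(-2w)/2.  As
   V'(0) = 0 < V(0) and only V and V' depend on w, first zeta_u + eta_v = 0 and
   then phi = 0.  Hence on a box zeta = zeta(u), eta = eta(v) and
   zeta' = - eta' is a constant c, so that (c, zeta - c u, eta + c v) is locally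
   constant on the connected set D. *)
Require Import Defs.
From mathcomp Require Import all_boot all_order all_algebra.
From mathcomp Require Import all_classical all_reals all_analysis.
From mathcomp Require Import ring lra.
Import Order.TTheory GRing.Theory Num.Theory numFieldNormedType.Exports.

Local Open Scope classical_set_scope.
Local Open Scope ring_scope.

(** * Derivatives along lines, and two criteria for constancy *)

(** The two difference quotients coincide for small [h], hence have the same limit. The spaces [V]
    and [W] may differ, which moves derivatives between the line, [J0] and [J1]; agreement near [0]
    suffices, which suits functions controlled only over an open [D]. *)
Lemma near_line_is_derive (R : realType) (V W : normedModType R) (f : V -> R)
    (g : W -> R) (a v : V) (b w : W) (d : R) :
  (\forall h \near (0 : R), f (h *: v + a) = g (h *: w + b)) ->
  is_derive b w g d -> is_derive a v f d.
Proof.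
move=> fg [dg <-]; have fgab : f a = g b.
  by have := nbhs_singleton fg; rewrite !scale0r !add0r.
have Q : (fun h : R => h^-1 *: ((f \o shift a) (h *: v) - f a)) @ 0^' =
    (fun h : R => h^-1 *: ((g \o shift b) (h *: w) - g b)) @ 0^'.
  have E : {near (0 : R)^',
      (fun h : R => h^-1 *: ((f \o shift a) (h *: v) - f a))
      =1 (fun h : R => h^-1 *: ((g \o shift b) (h *: w) - g b))}.
    apply: (@cvg_within _ (nbhs (0 : R))); apply: (filterS _ fg) => h fgh.
    by rewrite /= -fgab; congr (_ *: (_ - _)).
  rewrite eqEsubset; split; apply: near_eq_cvg => //.
  by apply: filterS E => h /= /esym.
by split; rewrite /derivable /derive Q.
Qed.

Lemma line_is_derive (R : realType) (V W : normedModType R) (f : V -> R)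
    (g : W -> R) (a v : V) (b w : W) (d : R) :
  (forall h, f (h *: v + a) = g (h *: w + b)) ->
  is_derive b w g d -> is_derive a v f d.
Proof.
move=> fg; apply: (@near_line_is_derive R V W f g a v b w d).
exact: (@filterE _ (nbhs (0 : R))).
Qed.

(** Mean value theorem on the segment between [x] and [y], which lies inside the open interval; the
    formula is symmetric in [x] and [y], so they may be ordered. *)
Lemma is_derive_cst_affine (R : realType) (f : R -> R) (l r c x y : R) :
  (forall t, l < t < r -> is_derive t 1 f c) -> l < x < r -> l < y < r ->
  f y = f x + c * (y - x).
Proof.
move=> df; wlog xy : x y / x <= y.
  move=> H xlr ylr; case: (leP x y) => [xy|/ltW yx]; first exact: H.
  rewrite (H y x) //; ring.
move=> xlr ylr.
have st z : z \in `[x, y]%R -> l < z < r by rewrite in_itv /=; lra.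
have [z z1||z _ E] := @MVT_segment _ f (fun=> c) _ _ xy.
- by apply: df; apply: st; apply: subset_itv_oo_cc z1.
- by apply: derivable_within_continuous => z /st zr; have [] := df z zr.
- by rewrite -E addrC subrK.
Qed.

(** The level set of [g] through [x] is nonempty, relatively open and relatively closed in [A]. *)
Lemma connected_locally_constant (T : topologicalType) (U : Type) (A : set T)
    (g : T -> U) (x y : T) :
  connected A -> (forall z, A z -> \forall t \near z, A t -> g t = g z) ->
  A x -> A y -> g y = g x.
Proof.
move=> cA lc Ax Ay.
suff : A `&` [set z | g z = g x] = A by move/seteqP => [_ /(_ y Ay)[]].
apply: cA; first by exists x.
  exists (interior [set z | A z -> g z = g x]); first exact: open_interior.
  apply/seteqP; split=> z [Az gz]; split=> //; last exact: nbhs_singleton gz Az.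
  by apply: filterS (lc z Az) => t /= H /H ->.
(* Local constancy also makes the other levels relatively open, so the level set is cut out of [A]
   by the complement of an open set. *)
exists (~` interior [set z | A z -> g z <> g x]).
  exact/open_closedC/open_interior.
apply/seteqP; split=> z [Az gz]; split=> //.
  by move/nbhs_singleton => /(_ Az).
apply: contrapT => gzx; apply: gz.
by apply: filterS (lc z Az) => t /= H /H ->.
Qed.

Section VariationalSymmetries.
Context {R : realType}.
Implicit Types (u v w wu wv wuu wuv wvv : R) (X : vfield R) (D : set (R * R)).

(** * Reduction of jet-space derivatives to the base and to one variable *)

(** Tuples nest to the left, so a point of [J1] is a point of [J0] followed by [p] and [q]; a
    direction in the base leaves these two frozen. *)
Lemma is_derive_horizontal (F : J1 R -> R) (f : J0 R -> R) (x e : J0 R)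
    (p q d : R) :
  (forall y, F (y, p, q) = f y) ->
  is_derive x e f d -> is_derive (x, p, q) (e, 0, 0) F d.
Proof.
move=> Ff; apply: line_is_derive => h; rewrite -Ff; congr F.
by congr (_, _, _) => /=; rewrite [h *: 0]mulr0 add0r.
Qed.

Lemma is_derive_wu (F : J1 R -> R) (f : R -> R) (x : J0 R) (p q d : R) :
  (forall t, F (x, t, q) = f t) ->
  is_derive p 1 f d -> is_derive (x, p, q) (0, 0, 0, 1, 0) F d.
Proof.
move=> Ff; apply: line_is_derive => h; rewrite -Ff; congr F.
by congr (_, _, _) => /=; rewrite -?[(0, 0, 0)]/(0 : J0 R) ?scaler0 ?add0r.
Qed.

Lemma is_derive_wv (F : J1 R -> R) (f : R -> R) (x : J0 R) (p q d : R) :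
  (forall t, F (x, p, t) = f t) ->
  is_derive q 1 f d -> is_derive (x, p, q) (0, 0, 0, 0, 1) F d.
Proof.
move=> Ff; apply: line_is_derive => h; rewrite -Ff; congr F.
by congr (_, _, _) => /=; rewrite -?[(0, 0, 0)]/(0 : J0 R) ?scaler0 ?add0r.
Qed.

Lemma is_derive_u (f : J0 R -> R) u v w d :
  is_derive u 1 (fun t => f (t, v, w)) d <-> is_derive (u, v, w) (1, 0, 0) f d.
Proof.
by split; apply: line_is_derive => h; congr f;
  congr (_, _, _) => /=; rewrite ?[h *: 0]mulr0 ?add0r.
Qed.

Lemma is_derive_v (f : J0 R -> R) u v w d :
  is_derive v 1 (fun t => f (u, t, w)) d <-> is_derive (u, v, w) (0, 1, 0) f d.
Proof.
by split; apply: line_is_derive => h; congr f;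
  congr (_, _, _) => /=; rewrite ?[h *: 0]mulr0 ?add0r.
Qed.

Lemma is_derive_w (f : J0 R -> R) u v w d :
  is_derive w 1 (fun t => f (u, v, t)) d <-> is_derive (u, v, w) (0, 0, 1) f d.
Proof.
by split; apply: line_is_derive => h; congr f;
  congr (_, _, _) => /=; rewrite ?[h *: 0]mulr0 ?add0r.
Qed.

(** * The symmetry condition as a polynomial in [wu] and [wv] *)

Lemma lagrangian_derive u v w p q :
  let y := (u, v, w, p, q) in
  [/\ 'D_(1, 0, 0, 0, 0) lagrangian y = 0,
      'D_(0, 1, 0, 0, 0) lagrangian y = 0,
      'D_(0, 0, 1, 0, 0) lagrangian y = expR (- 2 * w) - expR w,
      'D_(0, 0, 0, 1, 0) lagrangian y = - (1 / 2) * q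
    & 'D_(0, 0, 0, 0, 1) lagrangian y = - (1 / 2) * p].
Proof.
pose l x p q := @lagrangian R (x, p, q).
split; apply: derive_val.
- apply: (@is_derive_horizontal _ (fun x => l x p q)) => //.
  by apply/is_derive_u; rewrite /l /=; apply: is_derive_cst.
- apply: (@is_derive_horizontal _ (fun x => l x p q)) => //.
  by apply/is_derive_v; rewrite /l /=; apply: is_derive_cst.
- apply: (@is_derive_horizontal _ (fun x => l x p q)) => //.
  apply/is_derive_w; rewrite /l /=.
  have H : is_derive w 1 (fun t : R => expR (- 2 * t))
      (expR (- 2 * w) * (- 2 * 1)).
    by apply: (@is_derive1_comp _ expR (fun t => - 2 * t)).
  apply: is_derive_eq; rewrite /GRing.scale /=; lra.
- apply: (@is_derive_wu _ (fun t => l (u, v, w) t q)) => //; rewrite /l /=.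
  apply: is_derive_eq; rewrite /GRing.scale /=; lra.
- apply: (@is_derive_wv _ (fun t => l (u, v, w) p t)) => //; rewrite /l /=.
  apply: is_derive_eq; rewrite /GRing.scale /=; lra.
Qed.

(* [Defs.lift] is qualified because mathcomp's [fintype.lift] shadows it. *)
Lemma determining_polynomial X u v w wu wv wuu wuv wvv
    (zu zv zw eu ev ew fu fv fw : R) :
  let x := (u, v, w) in let z := (x, wu, wv, wuu, wuv, wvv) in
  is_derive x (1, 0, 0) (zeta X) zu -> is_derive x (0, 1, 0) (zeta X) zv ->
  is_derive x (0, 0, 1) (zeta X) zw -> is_derive x (1, 0, 0) (eta X) eu ->
  is_derive x (0, 1, 0) (eta X) ev -> is_derive x (0, 0, 1) (eta X) ew ->
  is_derive x (1, 0, 0) (phi X) fu -> is_derive x (0, 1, 0) (phi X) fv ->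
  is_derive x (0, 0, 1) (phi X) fw ->
  pr1 X lagrangian z
    + lagrangian (x, wu, wv)
      * (Du (Defs.lift (zeta X)) z + Dv (Defs.lift (eta X)) z) =
  - (phi X x * (expR w - expR (- 2 * w))
       + (expR w + 1 / 2 * expR (- 2 * w)) * (zu + ev))
  - (1 / 2 * fv + (expR w + 1 / 2 * expR (- 2 * w)) * zw) * wu
  - (1 / 2 * fu + (expR w + 1 / 2 * expR (- 2 * w)) * ew) * wv
  + 1 / 2 * zv * wu ^+ 2 + 1 / 2 * eu * wv ^+ 2 - fw * (wu * wv)
  + 1 / 2 * zw * (wu ^+ 2 * wv) + 1 / 2 * ew * (wu * wv ^+ 2).
Proof.
move=> x z zuP zvP zwP euP evP ewP fuP fvP fwP.
have [L1 L2 L3 L4 L5] := lagrangian_derive u v w wu wv.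
have ch (e : J0 R) (df dz de : R) :
    is_derive x e (phi X) df -> is_derive x e (zeta X) dz ->
    is_derive x e (eta X) de ->
    'D_(e, 0, 0) (characteristic X) (x, wu, wv) = df - dz * wu - de * wv.
  move=> fP zP eP; apply: derive_val.
  apply: (@is_derive_horizontal _
    (fun y => phi X y - zeta X y * wu - eta X y * wv)) => [[[]]//|].
  apply: is_derive_eq; rewrite /GRing.scale /=; ring.
(* The values [- zeta] here and [- eta] below cancel the second-order terms added in [phi_u] and
   [phi_v], so no [wuu], [wuv] or [wvv] survives. *)
have c4 : 'D_(0, 0, 0, 1, 0) (characteristic X) (x, wu, wv) = - zeta X x.
  apply: derive_val; apply: (@is_derive_wu _
    (fun t => phi X x - zeta X x * t - eta X x * wv)) => //.
  apply: is_derive_eq; rewrite /GRing.scale /=; ring.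
have c5 : 'D_(0, 0, 0, 0, 1) (characteristic X) (x, wu, wv) = - eta X x.
  apply: derive_val; apply: (@is_derive_wv _
    (fun t => phi X x - zeta X x * wu - eta X x * t)) => //.
  apply: is_derive_eq; rewrite /GRing.scale /=; ring.
have li (e : J0 R) f (df : R) : is_derive x e f df ->
    'D_(e, 0, 0) (Defs.lift f) (x, wu, wv) = df.
  by move=> fP; apply: derive_val; apply: is_derive_horizontal fP => -[[]].
have l4 f : 'D_(0, 0, 0, 1, 0) (Defs.lift f) (x, wu, wv) = 0.
  by apply: derive_val; apply: (@is_derive_wu _ (fun=> f x)).
have l5 f : 'D_(0, 0, 0, 0, 1) (Defs.lift f) (x, wu, wv) = 0.
  by apply: derive_val; apply: (@is_derive_wv _ (fun=> f x)).
rewrite /pr1 /phi_u /phi_v /Du /Dv /= L1 L2 L3 L4 L5 c4 c5 !l4 !l5.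
rewrite (ch _ _ _ _ fuP zuP euP) (ch _ _ _ _ fvP zvP evP).
rewrite (ch _ _ _ _ fwP zwP ewP).
rewrite (li _ _ _ zuP) (li _ _ _ evP) (li _ _ _ zwP) (li _ _ _ ewP) /x /=.
by field.
Qed.

(** Evaluation at eleven points with coordinates among -1, 0, 1, 2 gives a linear system for the
    coefficients. *)
Lemma cubic_eq0 (a b c d e f g h : R) :
  (forall p q : R, a + b * p + c * q + d * p ^+ 2 + e * q ^+ 2 + f * (p * q)
     + g * (p ^+ 2 * q) + h * (p * q ^+ 2) = 0) ->
  [/\ a = 0, (d = 0 /\ e = 0), f = 0 & (g = 0 /\ h = 0)].
Proof.
move=> H; have := H 0 0; have := H 1 0; have := H 0 1; have := H (- 1) 0.
have := H 0 (- 1); have := H 1 1; have := H (- 1) 1; have := H 1 (- 1).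
have := H (- 1) (- 1); have := H 2 1; have := H 1 2.
by move=> *; split; [|split| |split]; lra.
Qed.

Lemma smooth_is_derive M (f : J0 R -> R) x e : smooth M f -> M x ->
  e \in [:: (1, 0, 0); (0, 1, 0); (0, 0, 1)] -> is_derive x e f ('D_e f x).
Proof. by move=> /(_ 1%N)[_ fM] Mx /fM[/(_ x Mx) dfx _]; split. Qed.

(** At a fixed base point [wu] and [wv] range freely, so coefficients can be compared. The numbers
    [a] and [b] are [zeta_u] and [eta_v], still tied to [phi] by the constant coefficient. *)
Lemma determining_equations D X u v w :
  variational_symmetry D lagrangian X -> D (u, v) -> let x := (u, v, w) in
  [/\ is_derive x (0, 1, 0) (zeta X) 0 /\ is_derive x (0, 0, 1) (zeta X) 0,
      is_derive x (1, 0, 0) (eta X) 0 /\ is_derive x (0, 0, 1) (eta X) 0,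
      is_derive x (0, 0, 1) (phi X) 0 &
      exists a b : R, [/\ is_derive x (1, 0, 0) (zeta X) a,
        is_derive x (0, 1, 0) (eta X) b &
        phi X x * (expR w - expR (- 2 * w))
          + (expR w + 1 / 2 * expR (- 2 * w)) * (a + b) = 0]].
Proof.
move=> [[zs es fs] H] Duv x.
have Mx : (D `*` setT) x by [].
have i1 : (1, 0, 0) \in [:: (1, 0, 0); (0, 1, 0); (0, 0, 1) : J0 R].
  by rewrite !inE eqxx.
have i2 : (0, 1, 0) \in [:: (1, 0, 0); (0, 1, 0); (0, 0, 1) : J0 R].
  by rewrite !inE eqxx orbT.
have i3 : (0, 0, 1) \in [:: (1, 0, 0); (0, 1, 0); (0, 0, 1) : J0 R].
  by rewrite !inE eqxx !orbT.
have zu := smooth_is_derive _ _ _ _ zs Mx i1.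
have zv := smooth_is_derive _ _ _ _ zs Mx i2.
have zw := smooth_is_derive _ _ _ _ zs Mx i3.
have eu := smooth_is_derive _ _ _ _ es Mx i1.
have ev := smooth_is_derive _ _ _ _ es Mx i2.
have ew := smooth_is_derive _ _ _ _ es Mx i3.
have fu := smooth_is_derive _ _ _ _ fs Mx i1.
have fv := smooth_is_derive _ _ _ _ fs Mx i2.
have fw := smooth_is_derive _ _ _ _ fs Mx i3.
(* The second-order coordinates cancel, so setting them to [0] loses nothing. *)
have {}H p q := H u v w p q 0 0 0 Duv.
have P p q : _ = 0 := etrans (esym (determining_polynomial _ _ _ _ p q 0 0 0
  _ _ _ _ _ _ _ _ _ zu zv zw eu ev ew fu fv fw)) (H p q).
move: zu zv zw eu ev ew fu fv fw P; rewrite -/x.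
set zu := 'D__ _ _; set zv := 'D__ _ _; set zw := 'D__ _ _.
set eu := 'D__ _ _; set ev := 'D__ _ _; set ew := 'D__ _ _.
set fu := 'D__ _ _; set fv := 'D__ _ _; set fw := 'D__ _ _.
move=> zuP zvP zwP euP evP ewP fuP fvP fwP P.
have [P0 [zv0 eu0] fw0 [zw0 ew0]] : [/\ phi X x * (expR w - expR (- 2 * w))
          + (expR w + 1 / 2 * expR (- 2 * w)) * (zu + ev) = 0,
    zv = 0 /\ eu = 0, fw = 0 & zw = 0 /\ ew = 0].
  have [p q|] := @cubic_eq0 (- (phi X x * (expR w - expR (- 2 * w))
       + (expR w + 1 / 2 * expR (- 2 * w)) * (zu + ev)))
    (- (1 / 2 * fv + (expR w + 1 / 2 * expR (- 2 * w)) * zw))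
    (- (1 / 2 * fu + (expR w + 1 / 2 * expR (- 2 * w)) * ew))
    (1 / 2 * zv) (1 / 2 * eu) (- fw) (1 / 2 * zw) (1 / 2 * ew).
    by rewrite -[RHS](P p q); ring.
  by move=> ? [? ?] ? [? ?]; split; [|split| |split]; lra.
rewrite zv0 in zvP; rewrite zw0 in zwP; rewrite eu0 in euP.
rewrite ew0 in ewP; rewrite fw0 in fwP.
by split => //; exists zu, ev.
Qed.

(** * Independence of [w] and vanishing of [phi] *)

Lemma const_along_w (f : J0 R -> R) u v w w' :
  (forall t : R, is_derive (u, v, t) (0, 0, 1) f 0) ->
  f (u, v, w) = f (u, v, w').
Proof.
move=> df; apply: (@is_derive_0_is_cst _ (fun t => f (u, v, t))) => t.
exact/is_derive_w.
Qed.

Lemma symmetry_w_indep D X u v w w' :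
  variational_symmetry D lagrangian X -> D (u, v) -> X (u, v, w) = X (u, v, w').
Proof.
move=> S Duv; have E := determining_equations _ _ u v _ S Duv.
have z : zeta X (u, v, w) = zeta X (u, v, w').
  by apply: const_along_w => t; have [[]] := E t.
have e : eta X (u, v, w) = eta X (u, v, w').
  by apply: const_along_w => t; have [_ []] := E t.
have f : phi X (u, v, w) = phi X (u, v, w').
  by apply: const_along_w => t; have [_ _] := E t.
move: z e f; rewrite /zeta /eta /phi.
by case: (X _) => [[? ?] ?]; case: (X _) => [[? ?] ?] /= -> -> ->.
Qed.

Lemma near_line_open (D : set (R * R)) (u v : R) (e : R * R) :
  open D -> D (u, v) -> \forall h \near (0 : R), D (h *: e + (u, v)).
Proof.
move=> oD Duv.
have c : (fun h : R => h *: e + (u, v)) @ 0 --> (u, v).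
  rewrite -[X in _ --> X]add0r -(scale0r e).
  by apply: cvgD; [apply: cvgZr_tmp|apply: cvg_cst].
by apply: c; exact: open_nbhs_nbhs.
Qed.

(** The constant coefficient is read at two heights: [w = 0] isolates [zeta_u + eta_v], and then
    [w = 1] isolates [phi]. Independence of [w] carries the results to every height. *)
Lemma symmetry_conformal D X u v :
  open D -> variational_symmetry D lagrangian X -> D (u, v) ->
  exists c : R, forall w,
    [/\ is_derive (u, v, w) (1, 0, 0) (zeta X) c,
        is_derive (u, v, w) (0, 1, 0) (eta X) (- c) & phi X (u, v, w) = 0].
Proof.
move=> oD S Duv.
(* At [w = 0] the factor of [phi] is 1 - 1 = 0 and that of [a + b] is 3/2. *)
have [_ _ _ [a [b [za eb]]]] := determining_equations _ _ u v 0 S Duv.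
rewrite mulr0 subrr mulr0 add0r expR0 => ab0.
have {ab0} ba : b = - a by lra.
have za' w : is_derive (u, v, w) (1, 0, 0) (zeta X) a.
  apply: near_line_is_derive za; have := near_line_open _ _ _ (1, 0) oD Duv.
  apply: filterS => h Dh; rewrite /zeta; congr (_.1.1).
  (* [h * 0 + 0] is the third coordinate of [h *: (1, 0, 0) + (u, v, 0)]. *)
  by rewrite [LHS](symmetry_w_indep _ _ _ _ _ (h * 0 + 0) S).
have eb' w : is_derive (u, v, w) (0, 1, 0) (eta X) (- a).
  rewrite -ba.
  apply: near_line_is_derive eb; have := near_line_open _ _ _ (0, 1) oD Duv.
  apply: filterS => h Dh; rewrite /eta; congr (_.1.2).
  by rewrite [LHS](symmetry_w_indep _ _ _ _ _ (h * 0 + 0) S).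
exists a => w; split => //.
have -> : phi X (u, v, w) = phi X (u, v, 1).
  by rewrite /phi (symmetry_w_indep _ _ _ _ w 1 S).
(* At [w = 1] the derivatives are again [a] and [- a], so only [phi] times [expR 1 - expR (- 2 * 1)]
   remains, and this factor is nonzero. *)
have [_ _ _ [a' [b' [[_ za1] [_ eb1]]]]] :=
  determining_equations _ _ u v 1 S Duv.
have [_ za2] := za' 1; have [_ eb2] := eb' 1.
rewrite -za1 -eb1 za2 eb2 subrr mulr0 addr0 => /eqP; rewrite mulf_eq0.
case/orP => [/eqP//|]; rewrite subr_eq0 => /eqP/expR_inj; lra.
Qed.

(** * Affine form on boxes, and globalisation over [D] *)

Lemma near_translate_itv (l m s : R) : l < s < m ->
  \forall h \near (0 : R), l < h + s < m.
Proof.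
move=> lsm; have c : (fun h : R => h + s) @ (0 : R) --> s.
  by rewrite -[X in _ --> X]add0r; apply: cvgD; [exact: cvg_id|exact: cvg_cst].
have : s \in `]l, m[%R by rewrite in_itv.
move=> /near_in_itvoo sI; apply: (c (fun y => l < y < m)).
by apply: filterS sI => y /=; rewrite in_itv.
Qed.

(** Balls of the product are open squares. *)
Lemma open_box (D : set (R * R)) (u v : R) : open D -> D (u, v) ->
  exists2 r : R, 0 < r &
    forall s t : R, u - r < s < u + r -> v - r < t < v + r -> D (s, t).
Proof.
move=> oD Duv.
have /nbhs_ballP[r /= r0 rD] := open_nbhs_nbhs (conj oD Duv).
exists r => // s t sr tr; apply: rD.
by split; rewrite /ball /= ltr_distlC.
Qed.

(** In a box every point is joined to the two axes through the centre by coordinate segments, so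
    there [zeta] depends on [u] alone and [eta] on [v] alone. Separation of variables in
    [zeta_u = - eta_v] then forces both sides to be the constant [c]. *)
Lemma symmetry_affine_on_box D X u v (r c : R) :
  open D -> variational_symmetry D lagrangian X -> 0 < r ->
  (forall s t : R, u - r < s < u + r -> v - r < t < v + r -> D (s, t)) ->
  is_derive (u, v, 0) (1, 0, 0) (zeta X) c ->
  forall s t : R, u - r < s < u + r -> v - r < t < v + r ->
  [/\ is_derive (s, t, 0) (1, 0, 0) (zeta X) c,
      zeta X (s, t, 0) = zeta X (u, v, 0) + c * (s - u) &
      eta X (s, t, 0) = eta X (u, v, 0) - c * (t - v)].
Proof.
move=> oD S r0 box uc.
have ur : u - r < u < u + r by lra.
have vr : v - r < v < v + r by lra.
have zv (s t : R) : u - r < s < u + r -> v - r < t < v + r ->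
    zeta X (s, t, 0) = zeta X (s, v, 0).
  move=> sr tr; have := @is_derive_cst_affine _ (fun t => zeta X (s, t, 0))
    _ _ 0 v t _ vr tr.
  rewrite mul0r addr0; apply => y yr; apply/is_derive_v.
  by have [[]] := determining_equations _ _ s y 0 S (box _ _ sr yr).
have eu (s t : R) : u - r < s < u + r -> v - r < t < v + r ->
    eta X (s, t, 0) = eta X (u, t, 0).
  move=> sr tr; have := @is_derive_cst_affine _ (fun s => eta X (s, t, 0))
    _ _ 0 u s _ ur sr.
  rewrite mul0r addr0; apply => y yr; apply/is_derive_u.
  by have [_ []] := determining_equations _ _ y t 0 S (box _ _ yr tr).
have zc (s t d : R) : u - r < s < u + r -> v - r < t < v + r ->
    is_derive (s, v, 0) (1, 0, 0) (zeta X) d ->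
    is_derive (s, t, 0) (1, 0, 0) (zeta X) d.
  move=> sr tr /is_derive_u H; apply/is_derive_u.
  apply: (@near_line_is_derive R R^o R^o _ (fun x => zeta X (x, v, 0)) s 1 s 1).
  apply: filterS (near_translate_itv _ _ _ sr) => h hr.
  by rewrite [h *: 1]mulr1 zv.
have ec (s d : R) : u - r < s < u + r ->
    is_derive (s, v, 0) (0, 1, 0) (eta X) d ->
    is_derive (u, v, 0) (0, 1, 0) (eta X) d.
  move=> sr /is_derive_v H; apply/is_derive_v.
  apply: (@near_line_is_derive R R^o R^o _ (fun x => eta X (s, x, 0)) v 1 v 1).
  apply: filterS (near_translate_itv _ _ _ vr) => h hr.
  by rewrite [h *: 1]mulr1 (eu s).
(* On the horizontal axis [zeta_u] at [(s, v)] is [- eta_v] at [(s, v)], which equals [- eta_v] at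
   the centre because [eta] ignores [s]; this is [c]. *)
have dz (s t : R) : u - r < s < u + r -> v - r < t < v + r ->
    is_derive (s, t, 0) (1, 0, 0) (zeta X) c.
  move=> sr tr; apply: zc => //.
  have [a /(_ 0)[za ea _]] := symmetry_conformal _ _ _ _ oD S (box _ _ sr vr).
  have [b /(_ 0)[zb eb _]] := symmetry_conformal _ _ _ _ oD S (box _ _ ur vr).
  have [_ cE] := uc; have [_ bE] := zb; have [_ b'E] := eb.
  have [_ a'E] := ec _ _ sr ea.
  by have <- : a = c by apply: oppr_inj; rewrite -a'E b'E -cE bE.
have de (s t : R) : u - r < s < u + r -> v - r < t < v + r ->
    is_derive (s, t, 0) (0, 1, 0) (eta X) (- c).
  move=> sr tr; have [_ <-] := dz _ _ sr tr.
  have [a /(_ 0)[za ea _]] := symmetry_conformal _ _ _ _ oD S (box _ _ sr tr).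
  by have [_ ->] := za.
move=> s t sr tr; split; first exact: dz.
- rewrite zv //; apply: (@is_derive_cst_affine _ (fun s => zeta X (s, v, 0))
    _ _ _ _ _ _ ur sr) => y yr.
  exact/is_derive_u/dz.
- rewrite eu // -mulNr.
  apply: (@is_derive_cst_affine _ (fun t => eta X (u, t, 0))
    _ _ _ _ _ _ vr tr) => y yr.
  exact/is_derive_v/de.
Qed.

Lemma symmetry_span D X :
  D !=set0 -> open D -> connected D -> variational_symmetry D lagrangian X ->
  exists c1 c2 c3 : R, forall x : J0 R, (D `*` setT) x ->
    X x = c1 *: U1 x + c2 *: U2 x + c3 *: U3 x.
Proof.
move=> [[u0 v0] D0] oD cD S.
pose c (z : R * R) := 'D_(1, 0, 0) (zeta X) (z, 0 : R).
(* On the field [c1 *: U1 + c2 *: U2 + c3 *: U3] the map [g] takes the value [(c1, c2, c3)] over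
   [D]; its value at [(u0, v0)] therefore supplies the witnesses. *)
pose g (z : R * R) :=
  (c z, zeta X (z, 0) - c z * z.1, eta X (z, 0) + c z * z.2).
have gE z : D z -> g z = g (u0, v0).
  move=> Dz; apply: (@connected_locally_constant _ _ D) => // -[u v] Duv.
  have [r r0 box] := open_box _ _ _ oD Duv.
  apply/nbhs_ballP; exists r => // -[s t] [].
  rewrite /ball /= !ltr_distlC => sr tr _.
  have [a /(_ 0)[za _ _]] := symmetry_conformal _ _ _ _ oD S Duv.
  have [sa zE eE] :=
    symmetry_affine_on_box _ _ _ _ _ _ oD S r0 box za s t sr tr.
  rewrite /g /c; have [_ ->] := za; have [_ ->] := sa; rewrite zE eE /=.
  by congr (_, _, _); ring.
exists (c (u0, v0)), (zeta X (u0, v0, 0) - c (u0, v0) * u0),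
  (eta X (u0, v0, 0) + c (u0, v0) * v0) => -[[u v] w] [Duv _].
have [a /(_ w)[_ _ f0]] := symmetry_conformal _ _ _ _ oD S Duv.
have cE : c (u, v) = c (u0, v0) := congr1 (fun y => y.1.1) (gE _ Duv).
have zE : zeta X (u, v, 0) - c (u, v) * u =
    zeta X (u0, v0, 0) - c (u0, v0) * u0 :=
  congr1 (fun y => y.1.2) (gE _ Duv).
have eE : eta X (u, v, 0) + c (u, v) * v =
    eta X (u0, v0, 0) + c (u0, v0) * v0 :=
  congr1 snd (gE _ Duv).
rewrite -zE -eE -cE.
have -> : X (u, v, w) = (zeta X (u, v, 0), eta X (u, v, 0), 0).
  move: f0; rewrite /zeta /eta /phi (symmetry_w_indep _ _ _ _ w 0 S) //.
  by case: (X _) => [[a1 a2] a3] /= ->.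
have sE (k l : R) : k *: (l : R^o) = k * l by [].
by congr (_, _, _); rewrite /= !sE; ring.
Qed.

(** * The spanned fields are symmetries *)

Lemma affine_is_derive (D : set (R * R)) (f : J0 R -> R) (k a b u v w : R) e :
  open D -> (forall u v w, D (u, v) -> f (u, v, w) = k + a * u + b * v) ->
  D (u, v) -> is_derive (u, v, w) e f (a * e.1.1 + b * e.1.2).
Proof.
case: e => [[e1 e2] e3] oD fE Duv /=.
apply: (@near_line_is_derive R _ R^o _
  (fun t => k + a * (t * e1 + u) + b * (t * e2 + v)) _ _ 0 1).
  apply: filterS (near_line_open _ _ _ (e1, e2) oD Duv) => h Dh.
  by rewrite fE // addr0 [h *: 1]mulr1.
by apply: is_derive_eq; rewrite /GRing.scale /=; ring.
Qed.

Lemma affine_continuous D (g : J0 R -> R) (k a b : R) :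
  open D -> (forall u v w, D (u, v) -> g (u, v, w) = k + a * u + b * v) ->
  forall x, (D `*` setT) x -> {for x, continuous g}.
Proof.
move=> oD gE x [Dx _].
have gE' : {near x, (fun y : J0 R => k + a * y.1.1 + b * y.1.2) =1 g}.
  have : \forall y \near x, D y.1 by apply: cvg_fst; exact: open_nbhs_nbhs.
  by apply: filterS => -[[u v] w] /= Duv; rewrite gE.
rewrite /prop_for /continuous_at -(nbhs_singleton gE').
apply: cvg_trans (near_eq_cvg gE') _.
apply: cvgD; [apply: cvgD; [exact: cvg_cst|]|]; apply: cvgM;
  (try exact: cvg_cst);
  apply: (cvg_comp _ _ (@cvg_fst _ _ _ _ _)); [exact: cvg_fst|exact: cvg_snd].
Qed.

(** Functions affine over [D] are closed under directional derivatives, which are constant there;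
    hence the induction on the order generalises [f], [k], [a] and [b]. *)
Lemma affine_smooth (D : set (R * R)) (f : J0 R -> R) (k a b : R) :
  open D -> (forall u v w, D (u, v) -> f (u, v, w) = k + a * u + b * v) ->
  smooth (D `*` setT) f.
Proof.
move=> oD fE n; elim: n f k a b fE => [|n IH] f k a b fE; split=> //.
- exact: (affine_continuous D _ k a b).
- exact: (affine_continuous D _ k a b).
move=> e _; split=> [[[u v] w] [Duv _]|].
  by have [] := affine_is_derive _ _ _ _ _ _ _ w e oD fE Duv.
apply: (IH _ (a * e.1.1 + b * e.1.2) 0 0) => u v w Duv.
have [_ ->] := affine_is_derive _ _ _ _ _ _ _ w e oD fE Duv.
by rewrite !mul0r !addr0.
Qed.

(** Over [D] the components are affine with [zeta_u = c1], [eta_v = - c1], [phi = 0] and all other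
    first derivatives zero, so every coefficient of the determining polynomial vanishes. *)
Lemma span_symmetry D X (c1 c2 c3 : R) : open D ->
  (forall x : J0 R, (D `*` setT) x ->
     X x = c1 *: U1 x + c2 *: U2 x + c3 *: U3 x) ->
  variational_symmetry D lagrangian X.
Proof.
move=> oD XE.
have zE u v w : D (u, v) -> zeta X (u, v, w) = c2 + c1 * u + 0 * v.
  by move=> Duv; rewrite /zeta XE //= /GRing.scale /=; ring.
have eE u v w : D (u, v) -> eta X (u, v, w) = c3 + 0 * u + - c1 * v.
  by move=> Duv; rewrite /eta XE //= /GRing.scale /=; ring.
have fE u v w : D (u, v) -> phi X (u, v, w) = 0 + 0 * u + 0 * v.
  by move=> Duv; rewrite /phi XE //= /GRing.scale /=; ring.
split; first by split; [exact: affine_smooth zE|exact: affine_smooth eE|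
  exact: affine_smooth fE].
move=> u v w wu wv wuu wuv wvv Duv z.
have dz e := affine_is_derive _ _ _ _ _ _ _ w e oD zE Duv.
have de e := affine_is_derive _ _ _ _ _ _ _ w e oD eE Duv.
have df e := affine_is_derive _ _ _ _ _ _ _ w e oD fE Duv.
rewrite /z (determining_polynomial X _ _ _ _ _ _ _ _ _ _ _ _ _ _ _ _ _
  (dz _) (dz _) (dz _) (de _) (de _) (de _) (df _) (df _) (df _)) fE //=.
by field.
Qed.

End VariationalSymmetries.

Theorem theorem17 (R : realType) (D : set (R * R))
    (D_nonempty : D !=set0) (D_open : open D) (D_connected : connected D)
    (X : vfield R) :
  variational_symmetry D lagrangian X <->
  exists c1 c2 c3 : R, forall x : J0 R, (D `*` setT) x ->
    X x = c1 *: U1 x + c2 *: U2 x + c3 *: U3 x.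
Proof.
split; first exact: symmetry_span.
by move=> [c1 [c2 [c3]]]; exact: span_symmetry.
Qed.
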